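(* Let $n_1, n_2$ be two integers with $n_1, n_2 \geq 3$ and let $G$ be a graph of order $n = n_1 + n_2$. If $\sigma_2(G) \geq n+2$, then $G$ has two disjoint cycles of length $n_1$ and $n_2$, respectively.
   Context: All graphs are finite and simple. The order of a graph is its number of vertices. $d(x)$ denotes the degree of a vertex $x$ in $G$, and $$\sigma_2(G) = \min\{d(x)+d(y) : x, y \in V(G),\ x \neq y,\ xy \notin E(G)\},$$ with the usual convention $\sigma_2(G) = +\infty$ if $G$ is complete. The length of a cycle is its number of edges (equivalently vertices). ''Disjoint'' means vertex-disjoint. *)

(* Defs.v *)
From mathcomp Require Import all_boot.

Set Implicit Arguments.
Unset Strict Implicit.
Unset Printing Implicit Defensive.

(* A finite simple graph is a finType T of vertices with a symmetric and
   irreflexive adjacency relation e : rel T; both properties of e are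
   hypotheses of the theorem. *)

Definition degree (T : finType) (e : rel T) (x : T) : nat :=
  #|[set y | e x y]|.

Definition nonadjacent (T : finType) (e : rel T) : {set T * T} :=
  [set p | (p.1 != p.2) && ~~ e p.1 p.2].

(* The values lie in nat extended with +oo, where +oo is None; it is taken
   exactly when the graph is complete. *)
Definition sigma2 (T : finType) (e : rel T) : option nat :=
  let degree_sum (p : T * T) := degree e p.1 + degree e p.2 in
  if [pick p in nonadjacent e] is Some p0 then
    Some (degree_sum [arg min_(p < p0 in nonadjacent e) degree_sum p])
  else None.

Definition leq_infty (k : nat) (s : option nat) : bool :=
  if s is Some m then k <= m else true.

(* A cycle is listed by its vertices, without repeating the first one at the
   end, so that its length is the size of the list.  The lower bound on the size
   excludes the degenerate closed walks [::], [:: x] and [:: x; y] which the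
   library predicate ucycleb may accept. *)
Definition graph_cycle (T : finType) (e : rel T) (c : seq T) : bool :=
  (3 <= size c) && ucycleb e c.

(* Main.v *)
Require Import Defs.
From mathcomp Require Import all_boot zify.

(* If n1 = 3, G contains a triangle A whose complement B has a Hamiltonian path
   (take a Hamiltonian cycle of G - u and two consecutive neighbors of u).  If B
   is not Hamiltonian, the degree condition forces both ends of the path to be
   joined to all of A, and exchanging one end with a vertex of A gives another
   such pair; comparing two exchanges yields a contradiction.

   If n1, n2 >= 4, among the partitions (A, B) with |A| = n1 and both parts
   traceable (split a Hamiltonian cycle of G) take one maximizing e(A) + e(B).
   Exchange arguments show that one part, say B, is Hamiltonian.  Suppose that A
   is not, and let x, z be the ends of a Hamiltonian path of A.  Maximality
   makes B so dense that B - b + z satisfies Ore's condition for every b in B.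
   So it is enough to find b in B for which A - z + b is Hamiltonian.  Call two
   vertices of A linked if they are adjacent or their degrees in A add up to at
   least |A| + 2: by Bondy-Chvatal closure, links may be used as edges even
     after
   one exchange, and two unlinked vertices have a common neighbor in B.  If the
   exchange were never possible, A - x would carry a cycle C of links on which
   the vertices linked to x propagate in steps of two: for consecutive u, z, w
     on
   C, if x is linked to u then N_B(x) and N_B(w) are disjoint and x is linked to
   w.  Hence two such vertices e1, e2 at distance two on C have few neighbors in
   B and are linked to each other, and the chord e1 e2, together with x and a
   common neighbor b in B of x and of the successor of e2, closes a cycle
     through
   A - z + b, z being the vertex between e1 and e2. *)

Set Implicit Arguments.
Unset Strict Implicit.
Unset Printing Implicit Defensive.

(** * Cyclic orderings with few gaps *)

(* Boolean hypotheses other than inequalities make [lia] blow up. *)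
Ltac arith :=
  repeat match goal with
  | H : is_true ?b |- _ =>
      lazymatch b with leq _ _ => fail | _ => clear H end
  end; lia.

Section Gaps.
Variable T : finType.
Implicit Types (r e : rel T) (s c : seq T) (S : {set T}).

(** Counting missing edges, instead of forbidding them, treats Hamiltonian cycles and paths together
    and gives closure a decreasing measure. *)
Fixpoint gaps r x s : nat :=
  if s is y :: s' then ~~ r x y + gaps r y s' else 0.

Definition cgaps r c : nat := if c is x :: s then gaps r x (rcons s x) else 0.

Lemma gaps_cat r x s1 s2 :
  gaps r x (s1 ++ s2) = gaps r x s1 + gaps r (last x s1) s2.
Proof. by elim: s1 x => //= y s1 IH x; rewrite IH addnA. Qed.

Lemma gaps_rcons r x s y :
  gaps r x (rcons s y) = gaps r x s + ~~ r (last x s) y.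
Proof. by rewrite -cats1 gaps_cat /= addn0. Qed.

Lemma gaps_rev r x s : symmetric r ->
  gaps r (last x s) (rev (belast x s)) = gaps r x s.
Proof.
move=> r_sym; elim: s x => //= y s IH x.
rewrite rev_cons gaps_rcons IH addnC; congr (~~ _ + _).
by rewrite r_sym; case: s {IH} => //= z s; rewrite rev_cons last_rcons.
Qed.

Lemma gaps_path r x s : (gaps r x s == 0) = path r x s.
Proof. by elim: s x => //= y s IH x; rewrite addn_eq0 eqb0 negbK IH. Qed.

Lemma cgapsE r x s : cgaps r (x :: s) = gaps r x s + ~~ r (last x s) x.
Proof. by rewrite /= gaps_rcons. Qed.

Lemma cgaps_catC r s1 s2 : cgaps r (s1 ++ s2) = cgaps r (s2 ++ s1).
Proof.
case: s1 => [|x s1]; first by rewrite cats0.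
case: s2 => [|y s2]; first by rewrite cats0.
rewrite !cat_cons !cgapsE !gaps_cat !last_cat /=; lia.
Qed.

Lemma cgaps_rot r n c : cgaps r (rot n c) = cgaps r c.
Proof. by rewrite /rot cgaps_catC cat_take_drop. Qed.

Lemma cgaps_cycle r c : (cgaps r c == 0) = cycle r c.
Proof. by case: c => //= x s; rewrite gaps_path. Qed.

(* A consecutive pair of the closed walk [x :: rcons s x] becomes the closing
   pair of a rotation. *)
Lemma rot_to_pair x s s1 v s2 : rcons s x = s1 ++ v :: s2 ->
  exists i t, rot i (x :: s) = v :: t /\ last v t = last x s1.
Proof.
case/lastP: s2 => [|s2 w].
  by rewrite cats1 => /rcons_inj[<- <-]; exists 0, s; rewrite rot0.
rewrite -rcons_cons -rcons_cat => /rcons_inj[-> _].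
exists (size (x :: s1)), (s2 ++ x :: s1).
by rewrite -cat_cons rot_size_cat last_cat.
Qed.

Lemma gaps_lt_split r e x s : gaps r x s < gaps e x s ->
  exists s1 v s2, [/\ s = s1 ++ v :: s2, r (last x s1) v & ~~ e (last x s1) v].
Proof.
elim: s x => //= y s IH x lt_re.
case: (boolP (r x y && ~~ e x y)) => [/andP[rxy exy]|].
  by exists [::], y, s.
move=> h; have /IH[s1 [v [s2 [-> ruv euv]]]] : gaps r y s < gaps e y s.
  by move: h lt_re; case: (r x y); case: (e x y) => //=; lia.
by exists (y :: s1), v, s2.
Qed.

Lemma cgaps_lt_rot r e c : cgaps r c < cgaps e c ->
  exists i x t, [/\ rot i c = x :: t, r (last x t) x & ~~ e (last x t) x].
Proof.
case: c => //= x s /gaps_lt_split[s1 [v [s2 [E ruv euv]]]].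
by have [i [t [Ei lt]]] := rot_to_pair E; exists i, v, t; rewrite lt.
Qed.

Lemma pigeonhole_split (P Q : pred T) x s :
  size s < count P (belast x s) + count Q s ->
  exists s1 v s2, [/\ s = s1 ++ v :: s2, P (last x s1) & Q v].
Proof.
elim: s x => //= y s IH x lt_s.
case: (boolP (P x && Q y)) => [/andP[Px Qy]|]; first by exists [::], y, s.
move=> h; have /IH[s1 [v [s2 [-> Pu Qv]]]] :
    size s < count P (belast y s) + count Q s.
  by move: h lt_s; case: (P x); case: (Q y) => //=; lia.
by exists (y :: s1), v, s2.
Qed.

Definition covers c S := uniq c && ([set x in c] == S).

(* For [2 < #|S|], [spans e 0 S] says that the subgraph induced by [S] is
   Hamiltonian and [spans e 1 S] that it is traceable. *)
Definition spans r k S :=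
  [exists c : #|S|.-tuple T, covers c S && (cgaps r c <= k)].

Lemma covers_size c S : covers c S -> size c = #|S|.
Proof. by case/andP=> /card_uniqP <- /eqP <-; rewrite cardsE. Qed.

Lemma covers_mem c S : covers c S -> c =i S.
Proof. by case/andP=> _ /eqP <- x; rewrite inE. Qed.

Lemma covers_perm c c' S : perm_eq c c' -> covers c S -> covers c' S.
Proof.
move=> pcc /andP[uc /eqP <-]; rewrite /covers -(perm_uniq pcc) uc /=.
by apply/eqP/setP => x; rewrite !inE (perm_mem pcc).
Qed.

Lemma covers_rot n c S : covers c S -> covers (rot n c) S.
Proof. by apply: covers_perm; rewrite perm_sym perm_rot. Qed.

Lemma covers_rcons x c S : covers (rcons c x) S = covers (x :: c) S.
Proof. by apply/idP/idP; apply: covers_perm;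
  rewrite ?perm_rcons // perm_sym perm_rcons. Qed.

Lemma covers_del x c S : covers (x :: c) S -> covers c (S :\ x).
Proof.
case/andP=> /= /andP[xc uc] /eqP <-; rewrite /covers uc /=.
apply/eqP/setP => y; rewrite !inE; case: eqP => //= ->; exact: negbTE.
Qed.

Lemma covers_add x c S : x \notin S -> covers c S -> covers (x :: c) (x |: S).
Proof.
move=> xS cS; case/andP: (cS) => uc /eqP E;
  rewrite /covers /= uc (covers_mem cS) xS /=.
by apply/eqP/setP => y; rewrite -E !inE.
Qed.

Lemma covers_enum S : covers (enum S) S.
Proof. by rewrite /covers enum_uniq; apply/eqP/setP => x;
  rewrite inE mem_enum. Qed.

Lemma spansP r k S :
  reflect (exists c, covers c S /\ cgaps r c <= k) (spans r k S).
Proof.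
apply: (iffP existsP) => [[c /andP[cS ck]]|[c [cS ck]]]; first by exists c.
by exists (Tuple (introT eqP (covers_size cS))); rewrite /= cS.
Qed.

End Gaps.

(** * Closure and Ore's theorem *)

Section Graph.
Variables (T : finType) (e : rel T).
Hypotheses (e_sym : symmetric e) (e_irr : irreflexive e).
Implicit Types (r : rel T) (s c : seq T) (S : {set T}).

Definition deg_in S x := #|[set y in S | e x y]|.

Lemma deg_in_count c S x : covers c S -> count (e x) c = deg_in S x.
Proof.
move=> cS; case/andP: (cS) => uc _.
rewrite -size_filter -(card_uniqP _) ?filter_uniq //.
by apply: eq_card => y; rewrite mem_filter inE (covers_mem cS) andbC.
Qed.

Lemma deg_in_add S x y : y \notin S -> deg_in (y |: S) x = deg_in S x + e x y.
Proof.
move=> yS; rewrite /deg_in; case exy: (e x y).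
  have ->: [set z in y |: S | e x z] = y |: [set z in S | e x z].
    by apply/setP => z; rewrite !inE; case: eqP => //= ->; rewrite exy.
  by rewrite cardsU1 inE (negbTE yS) addnC.
rewrite addn0; apply: eq_card => z; rewrite !inE.
by case: eqP => //= ->; rewrite exy (negbTE yS).
Qed.

Lemma deg_in_del S x y : y \in S -> deg_in S x = deg_in (S :\ y) x + e x y.
Proof. by move=> yS; rewrite -deg_in_add ?setD1K // setD11. Qed.

Lemma deg_in_le S x : deg_in S x <= #|S|.
Proof. by apply: subset_leq_card; apply/subsetP => y;
  rewrite inE => /andP[]. Qed.

Lemma deg_in_setC S x : deg_in S x + deg_in (~: S) x = degree e x.
Proof.
rewrite /degree /deg_in -(cardsID S [set y | e x y]).
congr (_ + _); apply: eq_card => y; rewrite !inE; first by rewrite andbC.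
by [].
Qed.

(* Crossing argument: the closing pair [last x t, x] is a heavy non-edge, so
   some consecutive pair [u, v] of the path has [x ~ v] and [last x t ~ u]. *)
Lemma closure_step r x t S : symmetric r -> {in S &, subrel e r} ->
  covers (x :: t) S -> ~~ e (last x t) x -> r (last x t) x ->
  #|S| <= deg_in S (last x t) + deg_in S x ->
  exists c, [/\ covers c S, cgaps e c < cgaps e (x :: t)
    & cgaps r c <= cgaps r (x :: t)].
Proof.
move=> r_sym sub cS nlx rlx heavy.
set y := last x t in nlx rlx heavy *.
have pig : size t < count (e y) (belast x t) + count (e x) t.
  have <-: count (e y) (x :: t) = count (e y) (belast x t).
    by rewrite lastI -cats1 count_cat /= -/y e_irr !addn0.
  have <-: count (e x) (x :: t) = count (e x) t by rewrite /= e_irr.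
  by rewrite !(deg_in_count _ cS); rewrite -(covers_size cS) in heavy.
have [s1 [v [s2 [Et eyu exv]]]] := pigeonhole_split pig.
have ly : last v s2 = y by rewrite /y Et last_cat.
set u := last x s1 in eyu *.
(* Reversing the stretch from [v] to [y] replaces the pairs [(u, v)] and [(y, x)] by the edges
   [(u, y)] and [(v, x)]. *)
have cS' : covers (x :: s1 ++ rev (v :: s2)) S.
  apply: covers_perm cS; rewrite Et perm_cons perm_cat2l perm_sym.
  by rewrite perm_rev.
have old q : gaps q x t = gaps q x s1 + (~~ q u v + gaps q v s2).
  by rewrite Et gaps_cat.
have new q : symmetric q -> cgaps q (x :: s1 ++ rev (v :: s2)) =
    gaps q x s1 + (~~ q y u + gaps q v s2) + ~~ q x v.
  move=> q_sym; rewrite cgapsE gaps_cat last_cat.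
  have ->: last (last x s1) (rev (v :: s2)) = v by rewrite rev_cons last_rcons.
  rewrite {1}lastI rev_rcons ly /= -(gaps_rev v s2 q_sym) ly.
  by rewrite (q_sym y u) (q_sym x v).
exists (x :: s1 ++ rev (v :: s2)); split => //.
  by rewrite new // cgapsE old nlx eyu exv /=; lia.
rewrite new // cgapsE old rlx (sub y u) ?(sub x v) //=; first by lia.
all: rewrite -(covers_mem cS) ?Et /u -?cat_cons mem_cat.
all: by rewrite ?mem_head ?mem_last ?orbT // -ly mem_last orbT.
Qed.

(** Induction on the number of [e]-gaps: while it exceeds the number of [r]-gaps, some pair of the
    cyclic order is in [r] but not in [e], and the crossing argument there lowers the former without
    raising the latter. *)
Lemma spans_closure r k S : symmetric r -> {in S &, subrel e r} -> 1 < #|S| ->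
  {in S &, forall u v, u != v -> r u v -> ~~ e u v ->
     #|S| <= deg_in S u + deg_in S v} ->
  spans r k S -> spans e k S.
Proof.
move=> r_sym sub S_gt1 heavy /spansP[c].
have [m] := ubnP (cgaps e c); elim: m c => // m IH c lt_m [cS ck].
have [le_re|lt_re] := leqP (cgaps e c) (cgaps r c).
  by apply/spansP; exists c; split => //; apply: leq_trans ck.
have [i [x [t [E rlx elx]]]] := cgaps_lt_rot lt_re.
have xtS : covers (x :: t) S by rewrite -E covers_rot.
have memS := covers_mem xtS.
have [|c' [c'S lt_c' le_c']] := closure_step r_sym sub xtS elx rlx.
  apply: heavy => //; rewrite -?memS ?mem_last ?mem_head //.
  have := covers_size xtS; case/andP: xtS => /= /andP[xt _] _.
  case: t {E rlx elx memS} xt => [_ /= E|y t xt _];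
    first by rewrite -E in S_gt1.
  by apply: contraNneq xt => <-; rewrite /= mem_last.
rewrite -!E !cgaps_rot in lt_c' le_c'.
by apply: (IH c'); [lia | split => //; lia].
Qed.

(** Closure from the complete relation, for which every enumeration of [S] is gap-free. *)
Lemma ore_ham S : 1 < #|S| ->
  {in S &, forall u v, u != v -> ~~ e u v -> #|S| <= deg_in S u + deg_in S v} ->
  spans e 0 S.
Proof.
move=> S_gt1 ore; apply: (@spans_closure (fun _ _ => true)) => //.
  by move=> u v uS vS uv _; apply: ore.
apply/spansP; exists (enum S); split; first exact: covers_enum.
rewrite leqn0 cgaps_cycle; case: (enum S) => [|y s] //=.
by elim: (rcons s y) {1}y => //=.
Qed.

Lemma consecutive_neighbors c S b : covers c S -> #|S| < 2 * deg_in S b ->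
  exists i v t, [/\ rot i c = v :: t, e b v & e b (last v t)].
Proof.
case: c => [|x s] cS big.
  by have := deg_in_count b cS; rewrite /= => E; rewrite -E in big.
have cnt : count (e b) (rcons s x) = deg_in S b.
  by rewrite -(deg_in_count b cS); apply/permP; rewrite perm_rcons.
have pig : size (rcons s x) <
    count (e b) (belast x (rcons s x)) + count (e b) (rcons s x).
  rewrite belast_rcons (deg_in_count b cS) cnt size_rcons.
  by have /= -> := covers_size cS; lia.
have [s1 [v [s2 [E ebu ebv]]]] := pigeonhole_split pig.
by have [i [t [Et lt]]] := rot_to_pair E; exists i, v, t; rewrite lt.
Qed.

(** Put [b] between two consecutive neighbors: both new pairs lie in [r], so no gap is added. *)
Lemma spans_insert r k S b : {in b |: S &, subrel e r} -> b \notin S ->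
  #|S| < 2 * deg_in S b -> spans r k S -> spans r k (b |: S).
Proof.
move=> sub bS big /spansP[c [cS ck]].
have [i [v [t [Et ebv ebu]]]] := consecutive_neighbors cS big.
have vtS : covers (v :: t) S by rewrite -Et covers_rot.
apply/spansP; exists (b :: v :: t); split; first exact: covers_add.
apply: leq_trans ck; rewrite -(cgaps_rot r i c) Et !cgapsE /=.
have vS : v \in S by rewrite -(covers_mem vtS) mem_head.
have uS : last v t \in S by rewrite -(covers_mem vtS) mem_last.
have -> : r b v by apply: sub => //; rewrite !inE ?eqxx ?vS ?orbT.
have -> : r (last v t) b.
  by apply: sub; rewrite 1?e_sym // !inE ?eqxx ?uS ?orbT.
by rewrite /=; lia.
Qed.

Lemma ham_del S b : b \in S -> spans e 0 S -> spans e 1 (S :\ b).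
Proof.
move=> bS /spansP[c [cS ck]].
have [|i t E] := @rot_to T c b; first by rewrite (covers_mem cS).
have btS : covers (b :: t) S by rewrite -E covers_rot.
apply/spansP; exists t; split; first exact: covers_del btS.
move: ck; rewrite -(cgaps_rot e i) E cgapsE; case: t {E btS} => //= y t.
by rewrite gaps_rcons; lia.
Qed.

End Graph.

(** * Heavy pairs, ends of paths and exchanges *)

Section Heavy.
Variables (T : finType) (e : rel T).
Hypotheses (e_sym : symmetric e) (e_irr : irreflexive e).
Implicit Types (r : rel T) (s c t : seq T) (S A B : {set T}) (x y z a b : T).
Local Notation deg_in := (deg_in e).
Local Notation ham := (spans e 0).
Local Notation tr := (spans e 1).

(** With [m = #|S|] these are the pairs that closure may use as edges. The value [#|A| + 2] leaves
    room for deleting one vertex, which costs each of [u] and [v] at most one neighbor. *)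
Definition heavy S m : rel T :=
  fun u v => e u v || [&& u \in S, v \in S & m <= deg_in S u + deg_in S v].

Lemma heavy_sym S m : symmetric (heavy S m).
Proof. by move=> u v; rewrite /heavy e_sym andbCA addnC. Qed.

Lemma sub_heavy S m : subrel e (heavy S m).
Proof. by move=> u v uv; rewrite /heavy uv. Qed.

Lemma heavy_closure S k : 1 < #|S| -> spans (heavy S #|S|) k S -> spans e k S.
Proof.
move=> S_gt1; apply: spans_closure => //; first exact: heavy_sym.
  by move=> u v _ _; apply: sub_heavy.
by move=> u v _ _ _ /orP[->//|/and3P[]].
Qed.

Lemma spans_path r x t S : covers (x :: t) S -> path r x t -> spans r 1 S.
Proof.
move=> cS; rewrite -gaps_path => /eqP E; apply/spansP; exists (x :: t).
by rewrite cgapsE E; split=> //; apply: leq_b1.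
Qed.

Lemma spans_cycle r c S : covers c S -> cycle r c -> spans r 0 S.
Proof. by move=> cS; rewrite -cgaps_cycle => /eqP E; apply/spansP; exists c;
  rewrite E. Qed.

Definition swap A a b := b |: (A :\ a).

Lemma card_swap A a b : a \in A -> b \notin A -> #|swap A a b| = #|A|.
Proof. by move=> aA bA;
  rewrite cardsU1 !inE (negbTE bA) andbF (cardsD1 a A) aA. Qed.

(* [x] and [z] are the ends of a path covering [A] whose missing edges are heavy
   enough to be removed by closure after one vertex of [A] is exchanged. *)
Definition ends A x z := exists t,
  [/\ covers (z :: t) A, path (heavy A (#|A| + 2)) z t & last z t = x].

Lemma ends_sym A x z : ends A x z -> ends A z x.
Proof.
move=> [t [cA pt lt]]; exists (rev (belast z t)); rewrite -lt.
have E : rev (z :: t) = last z t :: rev (belast z t) by rewrite lastI rev_rcons.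
split.
- by rewrite -E; apply: covers_perm cA; rewrite perm_sym perm_rev.
- by rewrite rev_path; apply: sub_path pt => u v; rewrite heavy_sym.
- by case: t {cA pt lt E} => //= y t; rewrite rev_cons last_rcons.
Qed.

Lemma tr_ends S : tr S -> ~~ ham S -> exists x z, ends S x z.
Proof.
move=> /spansP[c [cS c_le1]] nham.
have c_gt0 : 0 < cgaps e c.
  by rewrite lt0n; apply: contra nham => /eqP E; apply/spansP; exists c;
    rewrite E.
(* Comparison with the complete relation locates the only missing edge of [c] and rotates it to the
   closing position. *)
have [|i [x [t [E _ elx]]]] := @cgaps_lt_rot T (fun _ _ => true) e c.
  suff /eqP-> : cgaps (fun _ _ => true) c == 0 by [].
  rewrite cgaps_cycle; case: (c) => [|y s] //=.
  by elim: (rcons s y) {1}y => //=.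
exists (last x t), x, t; split=> //; first by rewrite -E covers_rot.
have : path e x t.
  by rewrite -gaps_path; move: c_le1; rewrite -(cgaps_rot e i c) E cgapsE elx;
    arith.
by apply: sub_path; apply: sub_heavy.
Qed.

Lemma endsP A x z : ends A x z -> 1 < #|A| -> ~~ ham A ->
  [/\ x \in A, z \in A, x != z, ~~ e x z & deg_in A x + deg_in A z < #|A|].
Proof.
move=> [t [cA pt lt]] A_gt1 nham.
have xA : x \in A by rewrite -(covers_mem cA) -lt mem_last.
have zA : z \in A by rewrite -(covers_mem cA) mem_head.
have : ~~ heavy A #|A| x z.
  apply: contra nham => hxz; apply: heavy_closure => //;
    apply: (spans_cycle cA).
  rewrite /= rcons_path lt hxz andbT; apply: sub_path pt => u v.
  case/orP=> [/sub_heavy->//|/and3P[uA vA h]].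
  by rewrite /heavy uA vA /= orbC (leq_trans _ h) ?leq_addr.
rewrite negb_or xA zA /= -ltnNge => /andP[-> ->]; split=> //.
have := covers_size cA; case/andP: cA => /= /andP[zt _] _.
case: t lt zt {pt} => [_ _ /= E|y t /= <- zt _]; first by rewrite -E in A_gt1.
by apply: contraNneq zt => <-; exact: mem_last.
Qed.

Lemma heavy_swap A a b : a \in A -> b \notin A ->
  {in A :\ a &, subrel (heavy A (#|A| + 2)) (heavy (swap A a b) #|swap A a b|)}.
Proof.
move=> aA bA u v uA vA /orP[/sub_heavy//|/and3P[_ _ h]].
rewrite /heavy card_swap // /swap in_setU uA in_setU vA !orbT /=.
have b_notin : b \notin A :\ a by rewrite !inE (negbTE bA) andbF.
rewrite !deg_in_add //; rewrite !(deg_in_del e _ aA) in h.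
by apply/orP; right; arith.
Qed.

(** Without its end [x] the path still covers [A :\ x]. A vertex [b] heavy to [z] would extend it,
    and one adjacent to more than half of it could be inserted; the bounds say that both fail. *)
Lemma ends_swap A x z b : ends A x z -> 1 < #|A| -> ~~ ham A -> b \notin A ->
  ~~ tr (swap A x b) ->
  [/\ ~~ e b z, deg_in (A :\ x) b + deg_in A z < #|A|
    & 2 * deg_in (A :\ x) b < #|A|].
Proof.
move=> xz A_gt1 nham bA ntr; have [xA zA x_z exz _] := endsP xz A_gt1 nham.
case: xz => t [cA pt lt].
have [t' Et] : exists t', t = rcons t' x.
  case/lastP: t lt {cA pt} => [/= E|t' y]; first by rewrite E eqxx in x_z.
  by rewrite last_rcons => ->; exists t'.
rewrite Et in cA pt lt; rewrite -rcons_cons covers_rcons in cA.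
rewrite rcons_path in pt; have cAx := covers_del cA.
have b_notin : b \notin A :\ x by rewrite !inE (negbTE bA) andbF.
have cS : covers (b :: z :: t') (swap A x b) by apply: covers_add.
have S_gt1 : 1 < #|swap A x b| by rewrite card_swap.
set r2 := heavy (swap A x b) #|swap A x b|.
have pt' : path r2 z t'.
  case/andP: pt => pt _; apply: (sub_in_path (P := mem (A :\ x))) pt.
    exact: heavy_swap.
  by apply/allP => u; rewrite (covers_mem cAx).
have bz : ~~ r2 b z.
  apply: contra ntr => bz; apply: heavy_closure => //; apply: (spans_path cS).
  by rewrite /= -/r2 bz.
have bS : b \in swap A x b by rewrite !inE eqxx.
have zS : z \in swap A x b by rewrite !inE [z == x]eq_sym x_z zA orbT.
move: bz; rewrite /r2 /heavy negb_or card_swap // bS zS -ltnNge.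
rewrite !deg_in_add // e_irr (deg_in_del e z xA) (e_sym z b) (e_sym z x).
move=> /andP[ebz]; rewrite (negbTE exz) (negbTE ebz) !addn0 => h; split=> //.
rewrite ltnNge; apply: contra ntr => big; apply: heavy_closure => //.
apply: (spans_insert (e := e)) => //; last exact: spans_path cAx pt'.
  by move=> u v _ _; apply: sub_heavy.
by move: big; rewrite (cardsD1 x A) xA /=; arith.
Qed.

End Heavy.

(** * Exchanges in an optimal partition *)

Section Optimum.
Variables (T : finType) (e : rel T).
Hypotheses (e_sym : symmetric e) (e_irr : irreflexive e).
Hypothesis ore : forall u v, u != v -> ~~ e u v ->
  #|T| + 2 <= degree e u + degree e v.
Implicit Types (s t : seq T) (S A B : {set T}) (x y z a b c : T).
Local Notation deg_in := (deg_in e).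
Local Notation ham := (spans e 0).
Local Notation tr := (spans e 1).
Local Notation ends := (ends e).

(* What maximality of e(A) + e(B) says about exchanging [a] and [b]. *)
Definition optimal A B := forall a b, a \in A -> b \in B ->
  tr (swap A a b) -> tr (swap B b a) ->
  deg_in B a + deg_in A b <= deg_in A a + deg_in B b + 2 * e a b.

Lemma optimal_sym A B : optimal A B -> optimal B A.
Proof.
move=> opt b a bB aA trB trA; have := opt a b aA bB trA trB.
by rewrite (e_sym b a); arith.
Qed.

Lemma ore_in A B u v : B = ~: A -> u != v -> ~~ e u v ->
  #|A| + #|B| + 2 <= deg_in A u + deg_in B u + (deg_in A v + deg_in B v).
Proof. by move=> -> uv euv; rewrite cardsC !deg_in_setC; apply: ore. Qed.

Lemma neq_in_setC A B a b : B = ~: A -> a \in A -> b \in B -> a != b.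
Proof. by move=> ->; rewrite inE => aA; apply: contraNneq => <-. Qed.

Lemma notin_setC A B b : B = ~: A -> b \in B -> b \notin A.
Proof. by move=> ->; rewrite inE. Qed.

Lemma setC_sym A B : B = ~: A -> A = ~: B.
Proof. by move=> ->; rewrite setCK. Qed.

(** If the exchange failed, [x'] would be nonadjacent to [y] and have few neighbors in [A]. The
    degree condition would then make the exchange of the other ends [y] and [y'] possible on both
    sides, against optimality. *)
Lemma optimal_swap_traceable A B x y x' y' : B = ~: A -> 1 < #|A| -> 1 < #|B| ->
  optimal A B -> ~~ ham A -> ~~ ham B -> ends A x y -> ends B x' y' ->
  deg_in A x + deg_in B y <= deg_in A y + deg_in B x ->
  deg_in B x' + deg_in A y' <= deg_in B y' + deg_in A x' ->
  tr (swap A x x').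
Proof.
move=> AB A_gt1 B_gt1 opt nA nB xy xy' le_xy le_xy'; apply: contraT => ntr;
  suff []: False.
have BA := setC_sym AB.
have [xA yA x_y exy dA] := endsP e_sym e_irr xy A_gt1 nA.
have [xB yB x_y' exy' dB] := endsP e_sym e_irr xy' B_gt1 nB.
have ore_xy := ore_in AB x_y exy; have ore_xy' := ore_in AB x_y' exy'.
have [ex'y d1 d2] := ends_swap e_sym e_irr xy A_gt1 nA (notin_setC AB xB) ntr.
have ore1 := ore_in AB (neq_in_setC BA xB yA) ex'y.
have E1 := deg_in_del e x' xA.
have E2 := deg_in_del e y' yA.
have E3 := deg_in_del e y yB.
have tr1 : tr (swap A y y').
  apply: contraT => ntr1; suff []: False.
  have [_ _ d3] := ends_swap e_sym e_irr (ends_sym e_sym xy) A_gt1 nA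
    (notin_setC AB yB) ntr1.
  arith.
have tr2 : tr (swap B y' y).
  apply: contraT => ntr2; suff []: False.
  have [_ _ d3] := ends_swap e_sym e_irr (ends_sym e_sym xy') B_gt1 nB
    (notin_setC BA yA) ntr2.
  arith.
have := opt y y' yA yB tr1 tr2; arith.
Qed.

Lemma optimal_ham A B : B = ~: A -> 1 < #|A| -> 1 < #|B| ->
  optimal A B -> tr A -> tr B -> ham A || ham B.
Proof.
move=> AB A_gt1 B_gt1 opt trA trB; apply: contraT;
  rewrite negb_or => /andP[nA nB]; suff []: False.
have BA := setC_sym AB.
(* Let [x] be the end that loses least by leaving [A]: its degree into [A] minus its degree into [B]
   is at most that of [y]. *)
have [x [y [xy le_xy]]] : exists x y, ends A x y /\
    deg_in A x + deg_in B y <= deg_in A y + deg_in B x.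
  have [x [y xy]] := tr_ends trA nA.
  have [le|lt] := leqP (deg_in A x + deg_in B y) (deg_in A y + deg_in B x).
    by exists x, y.
  by exists y, x; split; [apply: ends_sym | arith].
have [x' [y' [xy' le_xy']]] : exists x y, ends B x y /\
    deg_in B x + deg_in A y <= deg_in B y + deg_in A x.
  have [x' [y' xy']] := tr_ends trB nB.
  have [le|lt] := leqP (deg_in B x' + deg_in A y') (deg_in B y' + deg_in A x').
    by exists x', y'.
  by exists y', x'; split; [apply: ends_sym | arith].
have tr1 : tr (swap A x x').
  exact: (optimal_swap_traceable AB A_gt1 B_gt1 opt nA nB xy xy').
have tr2 : tr (swap B x' x).
  exact: (optimal_swap_traceable BA B_gt1 A_gt1 (optimal_sym opt) nB nA xy' xy).
have [xA yA x_y exy dA] := endsP e_sym e_irr xy A_gt1 nA.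
have [xB yB x_y' exy' dB] := endsP e_sym e_irr xy' B_gt1 nB.
have ore_xy := ore_in AB x_y exy; have ore_xy' := ore_in AB x_y' exy'.
have := opt x x' xA xB tr1 tr2; arith.
Qed.

Lemma ham_last S (c : T) : ham S -> c \in S ->
  exists x t, [/\ covers (x :: t) S, cycle e (x :: t) & last x t = c].
Proof.
case/spansP => s [sS]; rewrite leqn0 cgaps_cycle => cs cS.
have [|i t E] := @rot_to T s c; first by rewrite (covers_mem sS).
have : covers (rcons t c) S by rewrite covers_rcons -E covers_rot.
have : cycle e (rcons t c) by rewrite -rot1_cons -E !rot_cycle.
case: t {E} => [|x t] ct tS; first by exists c, [::].
by exists x, (rcons t c); rewrite last_rcons.
Qed.

Lemma rot2 (r : rel T) u v s S : covers [:: u, v & s] S ->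
  cycle r [:: u, v & s] ->
  covers (s ++ [:: u; v]) S /\ cycle r (s ++ [:: u; v]).
Proof.
move=> cS cyc; have -> : s ++ [:: u; v] = rot 2 [:: u, v & s].
  by rewrite /rot /= drop0 take0.
by rewrite covers_rot // rot_cycle.
Qed.

(** * Exchanges when one part is Hamiltonian and the other is not *)

Section OneSide.
Variables A B : {set T}.
Hypotheses (AB : B = ~: A) (A_gt1 : 1 < #|A|) (B_gt1 : 1 < #|B|).
Hypotheses (opt : optimal A B) (nA : ~~ ham A) (hB : ham B).

Let BA : A = ~: B := setC_sym AB.

(** Here [x |: B] is not Hamiltonian, so [x] is not heavy to the successor [b1] of a neighbor on a
    Hamiltonian cycle of [B]. Exchanging [x] and [b1] keeps the side of [B] traceable, so either
    optimality or the failure of [swap A x b1] gives the second bound. *)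
Lemma unattachable x z b : ends A x z -> b \in B -> ~~ tr (swap B b x) ->
  2 * deg_in B x <= #|B| /\
  #|A| + 2 + 2 * deg_in B x <= #|B| + 2 * deg_in A x.
Proof.
move=> xz bB ntr.
have [xA zA x_z exz dxz] := endsP e_sym e_irr xz A_gt1 nA.
have xB : x \notin B := notin_setC BA xA.
have nD : ~~ ham (x |: B).
  apply: contra ntr => hD; rewrite /swap.
  have b_x : b != x by apply: contraNneq xB => <-.
  have -> : x |: B :\ b = (x |: B) :\ b.
    apply/setP=> w; rewrite !inE; case: (w =P x) => [->|_] //=.
    by rewrite eq_sym b_x.
  by apply: ham_del => //; rewrite inE bB orbT.
have dx : 2 * deg_in B x <= #|B|.
  rewrite leqNgt; apply: contra nD => big.
  by apply: (spans_insert (e := e)) => // u v _ _.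
split=> //.
have [c xc cB] : exists2 c : T, e x c & c \in B.
  have : 0 < deg_in B x.
    have := ore_in AB x_z exz; have := deg_in_le e B z; arith.
  by case/card_gt0P => c; rewrite inE => /andP[cB xc]; exists c.
have [b1 [t [tB ct lt]]] := ham_last hB cB.
have b1B : b1 \in B by rewrite -(covers_mem tB) mem_head.
have pt : path e b1 t by move: ct; rewrite /= rcons_path => /andP[].
have xtD : covers (x :: b1 :: t) (x |: B) by apply: covers_add.
have xb1 : ~~ heavy e (x |: B) #|x |: B| x b1.
  apply: contra nD => hxb; apply: heavy_closure => //.
    by rewrite cardsU1 xB /=; arith.
  apply: (spans_cycle xtD) => /=; rewrite hxb rcons_path lt /=.
  apply/andP; split; last by apply: sub_heavy; rewrite e_sym.
  by apply: sub_path pt; apply: sub_heavy.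
move: xb1; rewrite negb_or !inE eqxx b1B orbT /= -ltnNge => /andP[exb1].
rewrite !deg_in_add // e_irr (e_sym b1) (negbTE exb1) cardsU1 xB !addn0 add1n
  => dsum.
have tr2 : tr (swap B b1 x).
  have cS : covers (x :: t) (swap B b1 x).
    apply: covers_add; first by rewrite !inE (negbTE xB) andbF.
    exact: covers_del tB.
  have cS' : covers (rcons t x) (swap B b1 x) by rewrite covers_rcons.
  case: t lt pt {ct xtD cS} tB cS' => [_ _|y t' /= lt /andP[_ pt] _ cS'].
    by move/covers_size => /= E; move: B_gt1; rewrite -E.
  by apply: (spans_path cS'); rewrite rcons_path pt lt e_sym.
have x_b1 := neq_in_setC AB xA b1B.
have ore1 := ore_in AB x_b1 exb1.
have E1 := deg_in_del e b1 xA; rewrite e_sym (negbTE exb1) in E1.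
have [tr1|ntr1] := boolP (tr (swap A x b1)).
  have := opt xA b1B tr1 tr2; rewrite (negbTE exb1); arith.
have [_ _ d3] := ends_swap e_sym e_irr xz A_gt1 nA (notin_setC AB b1B) ntr1.
arith.
Qed.

(* The second alternative is the case where [swap A x b] is not traceable. *)
Lemma exchange_cases x z b : ends A x z -> b \in B -> tr (swap B b x) ->
  deg_in B x + deg_in A b <= deg_in A x + deg_in B b + 2 * e x b \/
  [/\ #|A| + #|B| + 2 <= deg_in A z + deg_in B z + (deg_in A b + deg_in B b),
      deg_in A b + deg_in A z < #|A| + e x b
    & 2 * deg_in A b < #|A| + 2 * e x b].
Proof.
move=> xz bB tr2.
have [xA zA x_z exz dxz] := endsP e_sym e_irr xz A_gt1 nA.
have [tr1|ntr1] := boolP (tr (swap A x b)); first by left; apply: opt.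
right; have [ebz d1 d2] := ends_swap e_sym e_irr xz A_gt1 nA (notin_setC AB bB)
  ntr1.
have E := deg_in_del e b xA; rewrite (e_sym b) in E; rewrite e_sym in ebz.
have := ore_in AB (neq_in_setC AB zA bB) ebz; split; arith.
Qed.

(** Exchange [b] with [x] or with [z]. They cannot both be unattachable: each would have at most
    half of [B] as neighbors, while together the ends have more than [#|B|] neighbors there. *)
Lemma end_deg_sum x z b : ends A x z -> b \in B -> ~~ e z b ->
  #|B| + 2 <= deg_in B z + deg_in B b.
Proof.
move=> xz bB ezb; have zx := ends_sym e_sym xz.
have [xA zA x_z exz dxz] := endsP e_sym e_irr xz A_gt1 nA.
have ore_xz := ore_in AB x_z exz.
have ore_zb := ore_in AB (neq_in_setC AB zA bB) ezb.
have e_le1 := leq_b1 (e x b).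
have [trx|/(unattachable xz bB)[x1 x2]] := boolP (tr (swap B b x)).
  by case: (exchange_cases xz bB trx) => [|[]]; arith.
have [trz|/(unattachable zx bB)[z1 z2]] := boolP (tr (swap B b z));
  last by arith.
by case: (exchange_cases zx bB trz) => [|[]]; rewrite (negbTE ezb); arith.
Qed.

(** Exchange [x] with [a] and [z] with [b] and add the bounds; if one end is unattachable, use the
    other end for both vertices. *)
Lemma other_deg_sum x z a b : ends A x z -> a \in B -> b \in B -> a != b ->
  ~~ e a b -> #|B| + 2 <= deg_in B a + deg_in B b + e z a + e z b.
Proof.
move=> xz aB bB a_b eab; have zx := ends_sym e_sym xz.
have [xA zA x_z exz dxz] := endsP e_sym e_irr xz A_gt1 nA.
have ore_xz := ore_in AB x_z exz.
have ore_ab := ore_in AB a_b eab.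
have := leq_b1 (e x a); have := leq_b1 (e x b).
have := leq_b1 (e z a); have := leq_b1 (e z b) => h1 h2 h3 h4.
have casesx c : c \in B -> (2 * deg_in B x <= #|B| /\
  #|A| + 2 + 2 * deg_in B x <= #|B| + 2 * deg_in A x) \/ tr (swap B c x).
  by move=> cB; case: (boolP (tr (swap B c x))) => [|/(unattachable xz cB)];
    [right|left].
have casesz c : c \in B -> (2 * deg_in B z <= #|B| /\
  #|A| + 2 + 2 * deg_in B z <= #|B| + 2 * deg_in A z) \/ tr (swap B c z).
  by move=> cB; case: (boolP (tr (swap B c z))) => [|/(unattachable zx cB)];
    [right|left].
have badx : 2 * deg_in B x <= #|B| /\
  #|A| + 2 + 2 * deg_in B x <= #|B| + 2 * deg_in A x ->
  #|B| + 2 <= deg_in B a + deg_in B b + e z a + e z b.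
  case=> x1 x2.
  case: (casesz a aB) => [[z1 z2]|tra]; first by arith.
  case: (casesz b bB) => [[z1 z2]|trb]; first by arith.
  by case: (exchange_cases zx aB tra) => [|[]];
    case: (exchange_cases zx bB trb) => [|[]]; arith.
have badz : 2 * deg_in B z <= #|B| /\
  #|A| + 2 + 2 * deg_in B z <= #|B| + 2 * deg_in A z ->
  #|B| + 2 <= deg_in B a + deg_in B b + e z a + e z b.
  case=> z1 z2.
  case: (casesx a aB) => [[x1 x2]|tra]; first by arith.
  case: (casesx b bB) => [[x1 x2]|trb]; first by arith.
  by case: (exchange_cases xz aB tra) => [|[]];
    case: (exchange_cases xz bB trb) => [|[]]; arith.
case: (casesx a aB) => [/badx//|tra]; case: (casesz b bB) => [/badz//|trb].
by case: (exchange_cases xz aB tra) => [|[]];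
  case: (exchange_cases zx bB trb) => [|[]]; arith.
Qed.

(** The surplus 2 in the two degree bounds pays for the adjacencies to [b] that a pair of vertices
    loses, so Ore's condition survives. *)
Lemma end_exchange_ham x z b : ends A x z -> b \in B -> ham (swap B b z).
Proof.
move=> xz bB; have [xA zA x_z exz dxz] := endsP e_sym e_irr xz A_gt1 nA.
have zB := notin_setC BA zA.
have zBb : z \notin B :\ b by rewrite !inE (negbTE zB) andbF.
have cardS := card_swap bB zB.
apply: ore_ham => //; rewrite cardS // => u v.
have main w : w \in B :\ b -> ~~ e z w ->
    #|B| <= deg_in (swap B b z) z + deg_in (swap B b z) w.
  rewrite !inE => /andP[w_b wB] ezw; rewrite !deg_in_add // e_irr.
  have := end_deg_sum xz wB ezw.
  rewrite !(deg_in_del e _ bB); have := leq_b1 (e z b); have := leq_b1 (e w b).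
  arith.
rewrite !in_setU1 => /orP[/eqP->|uB] /orP[/eqP->|vB] u_v euv.
- by rewrite eqxx in u_v.
- exact: main.
- by rewrite addnC main // e_sym.
move: uB vB; rewrite !inE => /andP[u_b uB] /andP[v_b vB].
have := other_deg_sum xz uB vB u_v euv.
rewrite !deg_in_add // !(deg_in_del e _ bB) !(e_sym _ z).
have := leq_b1 (e u b); have := leq_b1 (e v b); arith.
Qed.

(** * Links inside the non-Hamiltonian part *)

Local Notation link := (heavy e A (#|A| + 2)).

Let link_sym : symmetric link := heavy_sym e_sym A (#|A| + 2).

Lemma common_neighbor u w : #|B| < deg_in B u + deg_in B w ->
  exists2 b, b \in B & e b u && e b w.
Proof.
move=> big; have : [set y in B | e u y] :&: [set y in B | e w y] != set0.
  apply: contraTneq big => disj; rewrite -leqNgt /deg_in.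
  rewrite -cardsUI disj cards0 addn0; apply: subset_leq_card.
  by apply/subsetP => y; rewrite !inE => /orP[] /andP[].
case/set0Pn => b; rewrite !inE => /andP[/andP[bB ub] /andP[_ wb]].
by exists b; rewrite // !(e_sym b) ub.
Qed.

Lemma link_deg u w : u \in A -> w \in A -> u != w ->
  deg_in B u + deg_in B w <= #|B| -> link u w.
Proof.
move=> uA wA u_w small; rewrite /heavy uA wA /= -implyNb.
by apply/implyP => /(ore_in AB u_w); arith.
Qed.

Lemma path_exchange_ham a b w s : a \in A -> b \in B ->
  covers (w :: s) (A :\ a) -> path link w s -> e b w && e b (last w s) ->
  ham (swap A a b).
Proof.
move=> aA bB wsA pws /andP[bw blast]; have bA := notin_setC AB bB.
have cS : covers (b :: w :: s) (swap A a b).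
  by apply: covers_add => //; rewrite !inE (negbTE bA) andbF.
apply: heavy_closure => //; first by rewrite card_swap.
apply: (spans_cycle cS); rewrite /= rcons_path.
rewrite (sub_heavy _ _ bw) heavy_sym // (sub_heavy _ _ blast) andbT.
apply: (sub_in_path (P := mem (A :\ a))) pws; first exact: heavy_swap.
by apply/allP => u; rewrite (covers_mem wsA).
Qed.

Hypothesis no_exchange : forall a b, a \in A -> b \in B ->
  ham (swap A a b) -> ham (swap B b a) -> False.

(** Opening the cycle between [u] and [z] and appending [x] to [u] gives a path from [z] to [x], so
    [z] can be exchanged into [B]. A common neighbor of [x] and [w] would close the rest of the
    path, against [no_exchange]. *)
Lemma cycle_step x u z w s : x \in A -> covers (u :: z :: w :: s) (A :\ x) ->
  cycle link (u :: z :: w :: s) -> link x u ->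
  [/\ ends A x z, ~~ link x z, link x w & deg_in B x + deg_in B w <= #|B|].
Proof.
move=> xA cA cyc xu.
have xzA : covers (z :: w :: s ++ [:: u; x]) A.
  have : covers (x :: u :: z :: w :: s) A.
    by rewrite -(setD1K xA); apply: covers_add => //; rewrite !inE eqxx.
  apply: covers_perm; apply/permP => P; rewrite /= count_cat /=; arith.
have pz : path link z (w :: s ++ [:: u; x]).
  move: cyc => /= /and3P[_ ->]; rewrite rcons_path cat_path /= => /andP[-> ->].
  by rewrite link_sym xu.
have xz : ends A x z.
  exists (w :: s ++ [:: u; x]); split=> //; by rewrite /= last_cat.
have [_ zA x_z exz dxz] := endsP e_sym e_irr xz A_gt1 nA.
have : w \in A :\ x by rewrite -(covers_mem cA) !inE eqxx !orbT.
rewrite in_setD1 eq_sym => /andP[x_w wA].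
have small : deg_in B x + deg_in B w <= #|B|.
  rewrite leqNgt; apply/negP => /common_neighbor[b bB /andP[bx bw]].
  apply: (no_exchange zA bB); last exact: end_exchange_ham xz bB.
  apply: (path_exchange_ham zA bB (covers_del xzA)); first by case/andP: pz.
  by rewrite bw last_cat /= bx.
split=> //; last exact: link_deg.
by rewrite /heavy negb_or exz xA zA /= -ltnNge; arith.
Qed.

Lemma exchange_absurd : tr A -> 3 < #|A| -> False.
Proof.
move=> trA A_gt3.
(* Together the ends have more than [#|B|] neighbors in [B], so [x] has more than half of [B]; this
   later makes [e1] and [e2] linked. *)
have [x [y [xy le_yx]]] : exists x y, ends A y x /\ deg_in B y <= deg_in B x.
  have [x [y xy]] := tr_ends trA nA.
  have [le|lt] := leqP (deg_in B y) (deg_in B x).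
    by exists x, y; split=> //; apply: ends_sym.
  by exists y, x; split=> //; arith.
have [yA xA y_x eyx dyx] := endsP e_sym e_irr xy A_gt1 nA.
have ore_xy := ore_in AB y_x eyx.
case: (xy) => t [cA pt lt].
case: t cA pt lt => [/covers_size|v [/covers_size|z0 [/covers_size|w0 s0]]];
  try by move=> /= E; move: A_gt3; rewrite -E.
move=> cA pt lt; have cAx := covers_del cA.
have vA : v \in A by rewrite -(covers_mem cA) !inE eqxx orbT.
have xv : link x v by case/andP: pt.
have pv : path link v (z0 :: w0 :: s0) by case/andP: pt.
have v_y : v != y.
  case/andP: (cA) => /= /and3P[_ /negP vs _] _; apply/eqP => v_y; apply: vs.
  by rewrite v_y -lt; apply: (mem_last z0 (w0 :: s0)).
(* This link closes the path from [v] to [y] into a cycle of links on [A :\ x]. *)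
have yv : link y v.
  apply: link_deg => //; first by rewrite eq_sym.
  rewrite leqNgt; apply/negP => /common_neighbor[b bB byv].
  apply: (no_exchange xA bB); last exact: end_exchange_ham xy bB.
  by apply: (path_exchange_ham xA bB cAx pv); rewrite -lt andbC in byv *.
have lt' : last v (z0 :: w0 :: s0) = y := lt.
have cyc : cycle link (v :: z0 :: w0 :: s0) by rewrite /cycle rcons_path pv lt'.
have [_ _ xw0 small1] := cycle_step xA cAx cyc xv.
have [] := rot2 cAx cyc; rewrite cat_cons.
have [z [e2 [s ->]]] : exists z e2 s, s0 ++ [:: v; z0] = [:: z, e2 & s].
  case: (s0) => [|a [|b s]]; first by exists v, z0, [::].
    by exists a, v, [:: z0].
  by exists a, b, (s ++ [:: v; z0]).
move: w0 xw0 small1 {cA pt lt lt' cAx pv cyc} => e1 xe1 small1 cA cyc.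
have [xz _ xe2 small2] := cycle_step xA cA cyc xe1.
have [] := rot2 cA cyc.
(* On a cycle of three vertices the step from [e2] passes over [e1], which would then not be linked
   to [x]. *)
case: s cyc cA => [|z' s] cyc cA cA' cyc'.
  by have [_] := cycle_step xA cA' cyc' xe2; rewrite xe1.
have [xz' e1e2] : ends A x z' /\ e1 != e2.
  split; last by case/andP: cA => /=; rewrite !inE !negb_or => /andP[/and3P[]].
  move: cA' cyc'; rewrite !cat_cons;
    have [w [s' ->]] : exists w s', s ++ [:: e1; z] = w :: s'.
    by case: (s) => [|a s']; [exists e1, [:: z] | exists a, (s' ++ [:: e1; z])].
  by move=> cA' cyc'; have [] := cycle_step xA cA' cyc' xe2.
have [_ z'A x_z' exz' dxz'] := endsP e_sym e_irr xz' A_gt1 nA.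
have ore_xz' := ore_in AB x_z' exz'.
have [b bB xz'b] : exists2 b, b \in B & e b x && e b z'.
  by apply: common_neighbor; arith.
have [_ zA _ _ _] := endsP e_sym e_irr xz A_gt1 nA.
have inA w : w \in A :\ x -> w \in A by rewrite inE => /andP[].
have e1e2_link : link e2 e1.
  apply: link_deg; rewrite 1?eq_sym ?inA // -?(covers_mem cA) ?inE ?eqxx ?orbT
    //.
  arith.
apply: (no_exchange zA bB); last exact: end_exchange_ham xz bB.
(* The cycle reads [e1], [z], [e2], [z'], [s]. From [x] go to [e2], take the chord to [e1], then run
   backwards through [s] to [z']; only [z] is skipped, and [b] joins [z'] to [x]. *)
apply: (@path_exchange_ham z b x (e2 :: e1 :: rev (z' :: s))) => //.
- apply: covers_del; have : covers (x :: [:: e1, z, e2, z' & s]) A.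
    by rewrite -(setD1K xA); apply: covers_add => //; rewrite !inE eqxx.
  apply: covers_perm; apply/permP => P; rewrite /= count_rev /=; arith.
- rewrite /= xe2 e1e2_link /= lastI rev_rcons /= rev_path.
  move: cyc; rewrite /= rcons_path => /and5P[_ _ _ ps le1].
  rewrite link_sym le1 /=; apply: sub_path ps => u w /=.
  by rewrite link_sym.
- by rewrite /= rev_cons last_rcons.
Qed.

End OneSide.
End Optimum.

(** * Existence of the partition *)

Section Partition.
Variables (T : finType) (e : rel T).
Hypotheses (e_sym : symmetric e) (e_irr : irreflexive e).
Hypothesis ore : forall u v, u != v -> ~~ e u v ->
  #|T| + 2 <= degree e u + degree e v.
Implicit Types (s t : seq T) (S A B : {set T}) (x y z a b c : T).
Local Notation deg_in := (deg_in e).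
Local Notation ham := (spans e 0).
Local Notation tr := (spans e 1).

(** Twice the number of edges inside [S]. *)
Definition inner_deg S := \sum_(u in S) deg_in S u.

Lemma inner_deg_add S b : b \notin S ->
  inner_deg (b |: S) = inner_deg S + 2 * deg_in S b.
Proof.
move=> bS; rewrite /inner_deg big_setU1 //= deg_in_add // e_irr addn0.
under eq_bigr => u _ do rewrite deg_in_add //.
rewrite big_split /= mul2n -addnn addnCA; congr (_ + (_ + _)).
rewrite /deg_in -sum1_card big_mkcond [RHS]big_mkcond /=.
by apply: eq_bigr => u _; rewrite inE e_sym; case: (u \in S); case: (e b u).
Qed.

Lemma swap_setC A a b : a \in A -> b \notin A ->
  ~: swap A a b = swap (~: A) b a.
Proof.
move=> aA bA; have a_b : a != b by apply: contraNneq bA => <-.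
apply/setP => w; rewrite !inE negb_or negb_and negbK.
case: (w =P a) => [->|_] /=; first by rewrite a_b.
by [].
Qed.

Lemma traceable_partition n : n <= #|T| -> 1 < n -> 1 < #|T| - n ->
  exists A, [&& #|A| == n, tr A & tr (~: A)].
Proof.
move=> n_le n_gt1 n'_gt1.
have hT : ham [set: T].
  apply: ore_ham => //; rewrite cardsT; first by arith.
  have degT w : deg_in setT w = degree e w by apply: eq_card => y; rewrite !inE.
  by move=> u v _ _ uv euv; have := ore uv euv; rewrite !degT; arith.
case/spansP: hT => c [cT]; rewrite leqn0 cgaps_cycle => cc.
have sc : size c = #|T| by rewrite (covers_size cT) cardsT.
case/andP: (cT) => uc _.
have memc x : x \in c by rewrite (covers_mem cT) inE.
have pc : sorted e c by case: (c) cc => //= x s; rewrite rcons_path => /andP[].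
have sorted_tr S s : covers s S -> sorted e s -> 1 < #|S| -> tr S.
  move=> sS; rewrite -(covers_size sS); case: s sS => //= x s sS ps _.
  exact: spans_path sS ps.
have c1 : covers (take n c) [set x in take n c] by rewrite /covers take_uniq //
  eqxx.
have c2 : covers (drop n c) (~: [set x in take n c]).
  rewrite /covers drop_uniq //; apply/eqP/setP => x; rewrite !inE.
  have := memc x; rewrite -{1}(cat_take_drop n c) mem_cat.
  have : uniq (take n c ++ drop n c) by rewrite cat_take_drop.
  rewrite cat_uniq => /and3P[_ /hasPn/(_ x) disj _].
  by case: (x \in drop n c) disj => [/(_ isT)/negbTE-> | _] //=;
    rewrite orbF => ->.
exists [set x in take n c].
rewrite -(covers_size c1) size_take_min; apply/and3P; split.
- by rewrite sc; apply/eqP/minn_idPl.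
- by apply: (sorted_tr _ _ c1);
  rewrite ?take_sorted // -(covers_size c1) size_take_min sc; lia.
- by apply: (sorted_tr _ _ c2);
  rewrite ?drop_sorted // -(covers_size c2) size_drop sc.
Qed.

Lemma optimal_partition n : n <= #|T| -> 1 < n -> 1 < #|T| - n ->
  exists A, [/\ #|A| = n, tr A, tr (~: A) & optimal e A (~: A)].
Proof.
move=> n_le n_gt1 n'_gt1.
have [A0 PA0] := traceable_partition n_le n_gt1 n'_gt1.
pose P A := [&& #|A| == n, tr A & tr (~: A)].
case: (@arg_maxnP _ A0 P (fun A => inner_deg A + inner_deg (~: A)) PA0).
move=> A /and3P[/eqP cardA trA trCA] maxA.
exists A; split=> // a b aA; rewrite inE => bA tr1 tr2.
have aCA : a \notin ~: A by rewrite inE aA.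
have bCA : b \in ~: A by rewrite inE.
have /maxA : P (swap A a b) by rewrite /P card_swap // cardA eqxx tr1 swap_setC.
rewrite swap_setC // /swap !inner_deg_add ?inE ?(negbTE bA) ?aA ?andbF //.
have inner_del S u : u \in S ->
    inner_deg S = inner_deg (S :\ u) + 2 * deg_in (S :\ u) u.
  by move=> uS; rewrite -{1}(setD1K uS) inner_deg_add ?setD11.
(* An edge between [a] and [b] is counted in both gains but still runs between the new parts, hence
   the term [2 * e a b]. *)
rewrite (inner_del A a) // (inner_del (~: A) b) //.
have := deg_in_del e b aA; have := deg_in_del e a aA.
have := deg_in_del e b bCA; have := deg_in_del e a bCA.
rewrite !e_irr (e_sym b a); arith.
Qed.

Lemma large_partition n : 3 < n -> 3 < #|T| - n ->
  exists A, [/\ #|A| = n, ham A & ham (~: A)].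
Proof.
move=> n_gt3 n'_gt3.
have [|||A [cardA trA trB opt]] := @optimal_partition n; try by arith.
have cardB : #|~: A| = #|T| - n by rewrite cardsCs setCK cardA.
have A_gt1 : 1 < #|A| by arith.
have B_gt1 : 1 < #|~: A| by arith.
pose good := [exists A : {set T}, [&& #|A| == n, ham A & ham (~: A)]].
suff : good by case/existsP => A' /and3P[/eqP ? ? ?]; exists A'.
apply: contraT => ngood.
have nswap a b : a \in A -> b \in ~: A -> ham (swap A a b) ->
    ham (swap (~: A) b a) -> False.
  move=> aA; rewrite inE => bA h1 h2; case/negP: ngood; apply/existsP.
  by exists (swap A a b); rewrite card_swap // cardA eqxx h1 swap_setC.
have [hA|nA] := boolP (ham A); last first.
  have hB : ham (~: A).
    by have := optimal_ham e_sym e_irr ore erefl A_gt1 B_gt1 opt trA trB;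
      rewrite (negbTE nA).
  case: (exchange_absurd e_sym e_irr ore erefl A_gt1 B_gt1 opt nA hB nswap trA).
  by arith.
have nB : ~~ ham (~: A).
  by apply: contra ngood => hB; apply/existsP; exists A; rewrite cardA eqxx hA.
case: (exchange_absurd e_sym e_irr ore (esym (setCK A)) B_gt1 A_gt1
  (optimal_sym e_sym opt) nB hA _ trB); last by arith.
by move=> a b aA bB h1 h2; apply: (nswap b a).
Qed.

(** * The case of a triangle *)

Lemma clique_ham S : 1 < #|S| -> {in S &, forall u v, u != v -> e u v} -> ham S.
Proof. by move=> S_gt1 cl;
  apply: ore_ham => // u v uS vS /(cl _ _ uS vS) ->. Qed.

(** The ends have degree sum below [#|~: A|] inside the complement, so their degrees into [A] add up
    to at least six, the maximum possible. *)
Lemma triangle_ends A t x : #|A| = 3 -> 2 < #|~: A| -> ~~ ham (~: A) ->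
  covers (x :: t) (~: A) -> path e x t ->
  ~~ e x (last x t) /\ {in A, forall c, e x c && e (last x t) c}.
Proof.
move=> A3 B_gt2 nB cB pt; have B_gt1 : 1 < #|~: A| by arith.
have yx : ends e (~: A) (last x t) x.
  by exists t; split=> //; apply: sub_path pt; apply: sub_heavy.
have [_ _ y_x eyx dyx] := endsP e_sym e_irr yx B_gt1 nB.
have := ore_in ore (erefl (~: A)) y_x eyx; rewrite e_sym A3 => h.
have full u : 3 <= deg_in A u -> {in A, forall c, e u c}.
  rewrite -A3 => le c cA; have : [set y in A | e u y] == A.
    rewrite eqEcard le andbT; apply/subsetP => y; rewrite inE.
    by case/andP.
  by move/eqP/setP/(_ c); rewrite inE cA.
have := deg_in_le e A x; have := deg_in_le e A (last x t); rewrite A3 => h1 h2.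
split=> // c cA; rewrite !full //; arith.
Qed.

Lemma triangle_exists : 5 < #|T| -> exists A x t, [/\ #|A| = 3,
  {in A &, forall u v, u != v -> e u v}, covers (x :: t) (~: A) & path e x t].
Proof.
move=> T_gt5.
(* Otherwise all degree sums are too small for a nonadjacent pair, so [u] is adjacent to every other
   vertex, which contradicts its small degree. *)
have [u du] : exists u, #|T| < 2 * degree e u + 1.
  apply/existsP; apply: contraT; rewrite negb_exists => /forallP small.
  have /card_gt0P[u _] : 0 < #|T| by arith.
  have nbrs : [set y | e u y] = ~: [set u].
    apply/setP => y; rewrite !inE; case: eqVneq => [->|y_u];
      first by rewrite e_irr.
    apply: contraT => euy; rewrite eq_sym in y_u.
    by have := ore y_u euy; have := small u; have := small y;
      rewrite -!leqNgt; arith.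
  by have := small u; rewrite /degree nbrs cardsCs setCK cards1; arith.
have cardU : #|~: [set u]| = #|T| - 1 by rewrite cardsCs setCK cards1.
have degU w : degree e w = deg_in (~: [set u]) w + e w u.
  rewrite -(deg_in_setC e [set u]) addnC; congr (_ + _).
  rewrite -[[set u]]setU0 deg_in_add ?inE // /deg_in.
  by rewrite (_ : [set y in set0 | _] = set0) ?cards0 //; apply/setP => y;
    rewrite !inE.
have hU : ham (~: [set u]).
  apply: ore_ham => //; rewrite cardU; first by arith.
  move=> v w _ _ vw evw; have := ore vw evw; rewrite !degU.
  by have := leq_b1 (e v u); have := leq_b1 (e w u); arith.
case/spansP: hU => s [sU]; rewrite leqn0 cgaps_cycle => cs.
have [|i [v [t [E euv euw]]]] := consecutive_neighbors (e := e) (b := u) sU.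
  by have := degU u; rewrite cardU e_irr; arith.
have vtU : covers (v :: t) (~: [set u]) by rewrite -E covers_rot.
have cvt : cycle e (v :: t) by rewrite -E rot_cycle.
have size_t : 3 < size t by have /= := covers_size vtU; rewrite cardU; arith.
case/lastP: t euw vtU cvt size_t {E} => // t w.
rewrite last_rcons size_rcons; case: t => // x t euw vtU cvt _.
have [ewv pt] : e w v /\ path e x t.
  by move: cvt; rewrite /= !rcons_path last_rcons => /and3P[_ /andP[-> _] ->].
have cB : covers (x :: t) (~: [set u] :\ w :\ v).
  apply: covers_del; apply: covers_del; apply: covers_perm vtU.
  by apply/permP => P; rewrite /= -cats1 count_cat /=; arith.
have EB : ~: [set u] :\ w :\ v = ~: [set u; w; v].
  by apply/setP => y; rewrite !inE !negb_or; case: (y == u); case: (y == w);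
    case: (y == v).
rewrite EB in cB; exists [set u; w; v], x, t; split=> //.
  have [w_u v_u] : w != u /\ v != u.
    by split; apply/eqP => Eu; [move: euw | move: euv]; rewrite Eu e_irr.
  have v_w : v != w by apply/eqP => Eu; move: ewv; rewrite Eu e_irr.
  by rewrite setUC cardsU1 cards2 !inE negb_or v_u v_w eq_sym w_u.
move=> a b; rewrite !inE => /orP[/orP[]|] /eqP-> /orP[/orP[]|] /eqP-> //;
  by rewrite ?eqxx // e_sym.
Qed.

Lemma triangle_partition : 5 < #|T| ->
  exists A, [/\ #|A| = 3, ham A & ham (~: A)].
Proof.
move=> T_gt5; have [A [x [t [A3 clA cB pt]]]] := triangle_exists T_gt5.
have cardB : #|~: A| = #|T| - 3 by rewrite cardsCs setCK A3.
have hA : ham A by apply: clique_ham => //; rewrite A3.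
have [hB|nB] := boolP (ham (~: A)); first by exists A.
have B_gt2 : 2 < #|~: A| by arith.
have [nxy xyA] := triangle_ends A3 B_gt2 nB cB pt.
have xA : x \notin A by have := mem_head x t; rewrite (covers_mem cB) inE.
case: t cB pt nxy xyA => [/covers_size /= E|x2 t cB /= /andP[_ pt] _ xyA].
  by rewrite -E in B_gt2.
have /card_gt0P[c cA] : 0 < #|A| by rewrite A3.
have [c' ] : exists c', c' \in A :\ c.
  by apply/card_gt0P; have := cardsD1 c A; rewrite A3 cA; arith.
rewrite !inE => /andP[c'_c c'A].
pose goal := [exists A : {set T}, [&& #|A| == 3, ham A & ham (~: A)]].
suff : goal by case/existsP => A' /and3P[/eqP ? ? ?]; exists A'.
apply: contraT => no.
(* Trade [a] for the end [x]: [swap A a x] is again a triangle, and the path from [x2] followed by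
   [a] covers its complement, so [triangle_ends] applies. *)
have step a : a \in A ->
    ~~ e x2 a /\ {in swap A a x, forall b, e x2 b}.
  move=> aA; have A3' : #|swap A a x| = 3 by rewrite card_swap.
  have hA' : ham (swap A a x).
    apply: clique_ham; first by rewrite A3'.
    move=> u v; rewrite !in_setU1 => /orP[/eqP->|/setD1P[_ uA]]
      /orP[/eqP->|/setD1P[_ vA]].
    - by rewrite eqxx.
    - by case/andP: (xyA v vA).
    - by rewrite e_sym; case/andP: (xyA u uA).
    - exact: clA.
  have nB' : ~~ ham (~: swap A a x).
    by apply: contra no => hB'; apply/existsP; exists (swap A a x);
      rewrite A3' eqxx hA'.
  have cB' : covers (x2 :: rcons t a) (~: swap A a x).
    rewrite swap_setC // -rcons_cons covers_rcons; apply: covers_add.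
      by rewrite !inE aA andbF.
    exact: covers_del cB.
  have pt' : path e x2 (rcons t a).
    by rewrite rcons_path pt; case/andP: (xyA a aA).
  have [|] := triangle_ends A3' _ nB' cB' pt';
    first by rewrite cardsCs setCK A3'; arith.
  by rewrite last_rcons => ? h; split=> // b /h/andP[].
(* Exchanging [c] makes [x2] nonadjacent to [c]; exchanging [c'] leaves [c] in the triangle and
   makes them adjacent. *)
have [nxc _] := step c cA; have [_ /(_ c)] := step c' c'A.
by rewrite !inE [c == c']eq_sym c'_c cA orbT (negbTE nxc) => /(_ isT).
Qed.

End Partition.

(** * From the degree sum condition to two disjoint cycles *)

Lemma sigma2_ore (T : finType) (e : rel T) k : leq_infty k (sigma2 e) ->
  forall u v, u != v -> ~~ e u v -> k <= degree e u + degree e v.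
Proof.
rewrite /sigma2 => sig u v uv euv.
have uv_in : (u, v) \in nonadjacent e by rewrite inE /= uv.
case: pickP sig => [p0 p0_in|/(_ (u, v))]; last by rewrite uv_in.
case: arg_minnP => // p _ le_p /= /leq_trans; apply.
exact: le_p (u, v) uv_in.
Qed.

Lemma ham_graph_cycle (T : finType) (e : rel T) (S : {set T}) :
  2 < #|S| -> spans e 0 S ->
  exists c, [/\ graph_cycle e c, size c = #|S| & c =i S].
Proof.
move=> S_gt2 /spansP[c [cS]]; rewrite leqn0 cgaps_cycle => cc.
exists c; split; [|exact: covers_size|exact: covers_mem].
by rewrite /graph_cycle (covers_size cS) S_gt2 /ucycleb cc; case/andP: cS.
Qed.

Theorem theorem1p7 (n1 n2 : nat) (hn1 : 3 <= n1) (hn2 : 3 <= n2)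
    (T : finType) (e : rel T) (e_sym : symmetric e) (e_irr : irreflexive e)
    (order_G : #|T| = n1 + n2)
    (sigma2_G : leq_infty (n1 + n2 + 2) (sigma2 e)) :
  exists c1 c2 : seq T,
    [/\ graph_cycle e c1 /\ size c1 = n1,
        graph_cycle e c2 /\ size c2 = n2
      & [disjoint c1 & c2]].
Proof.
have ore := sigma2_ore sigma2_G; rewrite -order_G in ore.
have [A [cardA hA hB]] : exists A : {set T},
    [/\ #|A| = n1, spans e 0 A & spans e 0 (~: A)].
  have [->|n1_3] := eqVneq n1 3.
    by apply: triangle_partition => //; lia.
  have [n2_3|n2_3] := eqVneq n2 3; last by apply: large_partition => //; lia.
  have [|A [cardA hA hB]] := triangle_partition e_sym e_irr ore; first by lia.
  by exists (~: A); rewrite setCK cardsCs setCK cardA; split=> //; lia.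
have cardB : #|~: A| = n2 by rewrite cardsCs setCK; lia.
have [|c1 [gc1 sc1 mc1]] := ham_graph_cycle _ hA; first by rewrite cardA.
have [|c2 [gc2 sc2 mc2]] := ham_graph_cycle _ hB; first by rewrite cardB.
exists c1, c2; split; rewrite ?sc1 ?sc2 //.
rewrite (eq_disjoint mc1) disjoint_sym (eq_disjoint mc2) disjoint_sym.
by rewrite disjoints_subset setCK.
Qed.
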